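(* Let $u:\mathbb{H}^1\to\mathbb{R}$ be given by $u(x,y,t)=x-3yt-2x^3$. Then $\Delta_{\mathbb{H}^1}u=0$, and the function $$\mathcal{I}_u^{\mathbb{H}^1}(r)=\frac{1}{r^2}\int_{B_r^{\mathbb{H}^1}(0)}\frac{|\nabla_{\mathbb{H}^1}u(\xi)|^2}{|\xi|_{\mathbb{H}^1}^2}\,d\xi,\qquad r>0,$$ is monotone decreasing in a right neighborhood of $r=0$, i.e. there is $r_0>0$ such that $\mathcal{I}_u^{\mathbb{H}^1}$ is monotone decreasing on $(0,r_0)$.
   Context: $\mathbb{H}^1$ is the first Heisenberg group: $\mathbb{R}^3$ with points $\xi=(x,y,t)$ and group law $(x_1,y_1,t_1)\circ(x_2,y_2,t_2)=(x_1+x_2,y_1+y_2,t_1+t_2+2(x_2y_1-x_1y_2))$. The vector fields are $X=\partial_x+2y\,\partial_t$ and $Y=\partial_y-2x\,\partial_t$; the horizontal gradient is $\nabla_{\mathbb{H}^1}u=(Xu,Yu)$ with $|\nabla_{\mathbb{H}^1}u|^2=(Xu)^2+(Yu)^2$; the Kohn-Laplace operator is $\Delta_{\mathbb{H}^1}=X^2+Y^2$. The Koranyi norm is $|(x,y,t)|_{\mathbb{H}^1}=((x^2+y^2)^2+t^2)^{1/4}$ and $B_r^{\mathbb{H}^1}(0)=\{\xi:|\xi|_{\mathbb{H}^1}<r\}$. $d\xi$ is Lebesgue measure on $\mathbb{R}^3$. *)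

(* Defs.v *)
From HB Require Import structures.
From mathcomp Require Import all_boot all_order all_algebra.
From mathcomp Require Import all_classical all_reals all_analysis.

Set Implicit Arguments.
Unset Strict Implicit.
Unset Printing Implicit Defensive.

Import Order.TTheory GRing.Theory Num.Theory.
Import numFieldNormedType.Exports.

Local Open Scope classical_set_scope.
Local Open Scope ring_scope.

Section Heisenberg.
Context {R : realType}.

(* A point xi = (x, y, t) is a left-nested pair: x = xi.1.1, y = xi.1.2 and
   t = xi.2. *)
Implicit Types (u : R * R * R -> R) (xi : R * R * R) (r : R).

Definition partial_x u xi : R := 'D_((1, 0, 0) : R * R * R) u xi.
Definition partial_y u xi : R := 'D_((0, 1, 0) : R * R * R) u xi.
Definition partial_t u xi : R := 'D_((0, 0, 1) : R * R * R) u xi.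

Definition heisX u xi : R := partial_x u xi + 2 * xi.1.2 * partial_t u xi.
Definition heisY u xi : R := partial_y u xi - 2 * xi.1.1 * partial_t u xi.

Definition hgrad u xi : R * R := (heisX u xi, heisY u xi).
Definition hgrad_sqnorm u xi : R := (hgrad u xi).1 ^+ 2 + (hgrad u xi).2 ^+ 2.

Definition kohn_laplace u xi : R := heisX (heisX u) xi + heisY (heisY u) xi.

Definition koranyi_norm xi : R :=
  ((xi.1.1 ^+ 2 + xi.1.2 ^+ 2) ^+ 2 + xi.2 ^+ 2) `^ (4^-1).

Definition koranyi_ball r : set (R * R * R) :=
  [set xi | koranyi_norm xi < r].

Definition lebesgue3 :=
  ((@lebesgue_measure R \x @lebesgue_measure R) \x @lebesgue_measure R)%E.

(* Extended-real valued, so that a divergent integral is +oo and not a junk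
   real.  At the origin the quotient is 0 by the convention x / 0 = 0; this
   changes the integrand on a null set only. *)
Definition heis_functional u r : \bar R :=
  ((r ^+ 2)^-1%:E *
   \int[lebesgue3]_(xi in koranyi_ball r)
      (hgrad_sqnorm u xi / koranyi_norm xi ^+ 2)%:E)%E.

Definition u_cubic xi : R :=
  let: (x, y, t) := xi in x - 3 * y * t - 2 * x ^+ 3.

End Heisenberg.

(* Main.v *)
(* In the dilated variable delta_r(x, y, t) = (r x, r y, r^2 t), whose Jacobian
   is r^4, the functional becomes an integral over the unit Koranyi ball, and
   since X u = 1 - 6 (x^2 + y^2) and Y u = 6 x y - 3 t it is an even polynomial
   a - 12 b r^2 + c r^4 with b > 0.  The coefficients are finite because
   |xi|^-2 is integrable near 0: it is at most 4^(k+1) on the dyadic shell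
   2^-(k+1) <= |xi| < 2^-k, whose volume is O(16^-k). *)
Require Import Defs.
From HB Require Import structures.
From mathcomp Require Import all_boot all_order all_algebra.
From mathcomp Require Import all_classical all_reals all_analysis.
From mathcomp Require Import measurable_realfun ring lra.
Import Order.TTheory GRing.Theory Num.Theory.
Import numFieldNormedType.Exports.
Local Open Scope classical_set_scope.
Local Open Scope ring_scope.

(** * Change of variables for Lebesgue measure under dilations *)

(** The measure hypothesis makes [m] equal to [c] times its pushforward by [f], so the formula is
    integration against a pushforward. *)
Lemma ge0_integral_scale d (T : measurableType d) (R : realType)
    (m : {measure set T -> \bar R}) (f : T -> T) (c : R)
    (D : set T) (g : T -> \bar R) :
  0 <= c -> measurable_fun setT f ->
  (forall A, measurable A -> m A = c%:E * m (f @^-1` A))%E ->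
  measurable D -> measurable_fun D g -> (forall x, D x -> 0 <= g x)%E ->
  (\int[m]_(x in D) g x = c%:E * \int[m]_(x in f @^-1` D) g (f x))%E.
Proof.
move=> c0 mf mE mD mg g0.
rewrite -(@ge0_integral_pushforward _ _ _ _ _ _ mf)//; last first.
  by move=> x; rewrite inE => /g0.
rewrite -[c]/((NngNum c0)%:num) -ge0_integral_mscale//.
by apply: eq_measure_integral => A mA _; exact: mE.
Qed.

(** The section at [x] of the preimage of [A] is the [f2]-preimage of the section of [A] at [f1 x]:
    scaling [m2] inside the integral over sections gives [c2], and substituting by [f1] outside
    gives [c1]. *)
Lemma product_measure_scale d1 d2 (T1 : measurableType d1)
    (T2 : measurableType d2) (R : realType)
    (m1 : {measure set T1 -> \bar R})
    (m2 : {sigma_finite_measure set T2 -> \bar R})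
    (f1 : T1 -> T1) (f2 : T2 -> T2) (c1 c2 : R) :
  0 <= c1 -> 0 <= c2 ->
  measurable_fun setT f1 -> measurable_fun setT f2 ->
  (forall A, measurable A -> m1 A = c1%:E * m1 (f1 @^-1` A))%E ->
  (forall A, measurable A -> m2 A = c2%:E * m2 (f2 @^-1` A))%E ->
  forall A, measurable A ->
  ((m1 \x m2) A =
   (c1 * c2)%:E * (m1 \x m2) ((fun x => (f1 x.1, f2 x.2)) @^-1` A))%E.
Proof.
move=> c10 c20 mf1 mf2 m1E m2E A mA.
pose f (x : T1 * T2) := (f1 x.1, f2 x.2).
have mf : measurable_fun setT f.
  by apply: measurable_fun_pair; exact: measurableT_comp.
have mfA : measurable (f @^-1` A).
  by rewrite -[X in measurable X]setTI; exact: mf.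
rewrite /product_measure1 (@ge0_integral_scale _ _ _ m1 f1 c1)//; last first.
  exact: measurable_fun_xsection.
rewrite EFinM -muleA; congr (_ * _)%E.
rewrite -ge0_integralZl_EFin//; last exact: measurable_fun_xsection.
apply: eq_integral => x _ /=.
rewrite m2E; last exact: measurable_xsection.
by congr (_ * m2 _)%E; apply/seteqP; split=> y /=; rewrite /xsection/= !inE.
Qed.

(** The right-hand side is itself a measure in [A], and it gives half-open intervals their length;
    uniqueness of Lebesgue measure does the rest. *)
Lemma lebesgue_measure_scale (R : realType) (k : R)
    (A : set (measurableTypeR R)) :
  0 < k -> measurable A ->
  (lebesgue_measure A = k%:E * lebesgue_measure ( *%R k @^-1` A))%E.
Proof.
move=> k0 mA.
apply: (@lebesgue_measure_unique _ (mscale (NngNum (ltW k0))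
    (pushforward lebesgue_measure ( *%R k : _ -> measurableTypeR R)))) => //.
move=> _ [[a b]] _ <-.
rewrite /= /mscale/= /pushforward.
rewrite (_ : _ @^-1` _ = `](k^-1 * a), (k^-1 * b)]%classic); last first.
  by apply/seteqP; split=> x /=; rewrite !in_itv/= ltr_pdivrMl// ler_pdivlMl.
rewrite !lebesgue_measure_itv/= !lte_fin ltr_pM2l ?invr_gt0//.
case: ifPn => // _; last by rewrite mule0.
by rewrite -!EFinD -EFinM; congr EFin; field; rewrite gt_eqF.
Qed.

Definition dilation {R : realType} (r : R) (xi : R * R * R) : R * R * R :=
  ((r * xi.1.1, r * xi.1.2), r ^+ 2 * xi.2).

Lemma measurable_dilation (R : realType) (r : R) :
  measurable_fun setT (dilation r).
Proof.
do 2?[apply: measurable_fun_pair]; apply: measurable_funM => //;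
do ? apply: measurableT_comp => //.
Qed.

(** The dilation acts on each coordinate separately, with factors [r], [r] and [r ^+ 2]; the
    exponent 4 is the homogeneous dimension. *)
Lemma lebesgue3_dilation (R : realType) (r : R) (A : set (R * R * R)) :
  0 < r -> measurable A ->
  (@lebesgue3 R A = (r ^+ 4)%:E * lebesgue3 (dilation r @^-1` A))%E.
Proof.
move=> r0 mA; have r0' := ltW r0.
rewrite (_ : r ^+ 4 = r * r * r ^+ 2) /lebesgue3; last by ring.
refine (@product_measure_scale _ _ (measurableTypeR R * measurableTypeR R)%type
  (measurableTypeR R) R (@lebesgue_measure R \x @lebesgue_measure R)%E
  (@lebesgue_measure R) (fun x : R * R => (r * x.1, r * x.2)) ( *%R (r ^+ 2))
  (r * r) (r ^+ 2) _ _ _ _ _ _ A mA); rewrite ?mulr_ge0//.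
- by apply: measurable_fun_pair; apply: measurableT_comp => //;
    exact: mulrl_measurable.
- move=> B mB; refine (@product_measure_scale _ _ (measurableTypeR R)
    (measurableTypeR R) R (@lebesgue_measure R) (@lebesgue_measure R)
    ( *%R r) ( *%R r) r r _ _ _ _ _ _ B mB) => // C mC;
  exact: lebesgue_measure_scale.
- by move=> C mC; apply: lebesgue_measure_scale => //; rewrite exprn_gt0.
Qed.

(** * Horizontal derivatives of [u_cubic] and its harmonicity *)

(** Every function differentiated below is a polynomial of degree at most 3 along each line, so its
    difference quotient is a quadratic in [h], and checking the expansion is left to [ring]. *)
Lemma derive_of_expansion (R : realType) (V : normedModType R) (f : V -> R)
    (a v : V) (c0 c1 c2 : R) :
  (forall h, f (h *: v + a) = f a + h * (c0 + h * c1 + h ^+ 2 * c2)) ->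
  'D_v f a = c0.
Proof.
move=> fE; rewrite /derive; apply/cvg_lim => //.
apply: (@cvg_trans _ ((fun h : R => c0 + h * c1 + h ^+ 2 * c2) @ 0^')).
  apply: near_eq_cvg; near=> h.
  have h0 : h != 0 by near: h; exact: nbhs_dnbhs_neq.
  by rewrite /= fE [f a + _]addrC addrK scalerA mulVf// scale1r.
(* The limit is written as the value of the quadratic at [h = 0], to match it term by term. *)
have c0E : c0 = c0 + 0 * c1 + 0 ^+ 2 * c2 by ring.
rewrite {2}c0E; apply: cvg_within_filter.
apply: cvgD; first (apply: cvgD; first exact: cvg_cst).
- by apply: cvgM; [exact: cvg_id|exact: cvg_cst].
- by apply: cvgM; [exact: exprn_continuous|exact: cvg_cst].
Unshelve. all: by end_near. Qed.

Lemma heisX_u_cubic (R : realType) (xi : R * R * R) :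
  heisX (@u_cubic R) xi = 1 - 6 * (xi.1.1 ^+ 2 + xi.1.2 ^+ 2).
Proof.
case: xi => [[x y] t].
rewrite /heisX /partial_x /partial_t.
rewrite (@derive_of_expansion _ _ _ _ _ (1 - 6 * x ^+ 2) (- 6 * x) (-2)).
  rewrite (@derive_of_expansion _ _ _ _ _ (- 3 * y) 0 0).
    by rewrite /=; ring.
  by move=> h; rewrite /u_cubic /= /GRing.scale/=; ring.
by move=> h; rewrite /u_cubic /= /GRing.scale/=; ring.
Qed.

Lemma heisY_u_cubic (R : realType) (xi : R * R * R) :
  heisY (@u_cubic R) xi = 6 * xi.1.1 * xi.1.2 - 3 * xi.2.
Proof.
case: xi => [[x y] t].
rewrite /heisY /partial_y /partial_t.
rewrite (@derive_of_expansion _ _ _ _ _ (- 3 * t) 0 0).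
  rewrite (@derive_of_expansion _ _ _ _ _ (- 3 * y) 0 0).
    by rewrite /=; ring.
  by move=> h; rewrite /u_cubic /= /GRing.scale/=; ring.
by move=> h; rewrite /u_cubic /= /GRing.scale/=; ring.
Qed.

(** [X (X u) = - 12 x], while [Y (Y u) = 6 x - 2 x (- 3) = 12 x]. *)
Lemma kohn_laplace_u_cubic (R : realType) (xi : R * R * R) :
  kohn_laplace (@u_cubic R) xi = 0.
Proof.
rewrite /kohn_laplace (funext (@heisX_u_cubic R)) (funext (@heisY_u_cubic R)).
case: xi => [[x y] t].
rewrite /heisX /heisY /partial_x /partial_y /partial_t.
rewrite (@derive_of_expansion _ _ _ _ _ (- 12 * x) (- 6) 0); last first.
  by move=> h /=; rewrite /GRing.scale/=; ring.
rewrite (@derive_of_expansion _ _ _ _ _ 0 0 0); last first.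
  by move=> h /=; rewrite /GRing.scale/=; ring.
rewrite (@derive_of_expansion _ _ _ _ _ (6 * x) 0 0); last first.
  by move=> h /=; rewrite /GRing.scale/=; ring.
rewrite (@derive_of_expansion _ _ _ _ _ (- 3) 0 0); last first.
  by move=> h /=; rewrite /GRing.scale/=; ring.
by rewrite /=; ring.
Qed.

(** * The Koranyi norm and the volume of its balls *)

HB.instance Definition _ (R : realType) := Measure.on (@lebesgue3 R).

Lemma koranyi_norm_ge0 (R : realType) (xi : R * R * R) : 0 <= koranyi_norm xi.
Proof. exact: powR_ge0. Qed.

(** Fourth powers remove the root, which turns later comparisons of norms into polynomial ones. *)
Lemma koranyi_normX4 (R : realType) (xi : R * R * R) :
  koranyi_norm xi ^+ 4 = (xi.1.1 ^+ 2 + xi.1.2 ^+ 2) ^+ 2 + xi.2 ^+ 2.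
Proof.
rewrite /koranyi_norm -powR_mulrn ?powR_ge0// -powRrM mulVf// powRr1//.
by rewrite addr_ge0// sqr_ge0.
Qed.

Lemma koranyi_norm_dilation (R : realType) (r : R) (xi : R * R * R) : 0 <= r ->
  koranyi_norm (dilation r xi) = r * koranyi_norm xi.
Proof.
move=> r0; apply/eqP.
rewrite -(@eqrXn2 _ 4) ?mulr_ge0 ?koranyi_norm_ge0//.
by rewrite exprMn !koranyi_normX4 /=; apply/eqP; ring.
Qed.

Lemma koranyi_norm_lt (R : realType) (xi : R * R * R) (r : R) : 0 <= r ->
  (koranyi_norm xi < r) =
  ((xi.1.1 ^+ 2 + xi.1.2 ^+ 2) ^+ 2 + xi.2 ^+ 2 < r ^+ 4).
Proof.
by move=> r0; rewrite -koranyi_normX4 ltr_pXn2r ?nnegrE ?koranyi_norm_ge0.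
Qed.

Lemma dilation_koranyi_ball (R : realType) (r s : R) : 0 < r ->
  dilation r @^-1` koranyi_ball (r * s) = koranyi_ball s.
Proof.
move=> r0; apply/seteqP; split=> xi;
by rewrite /koranyi_ball/= koranyi_norm_dilation ?ltW// ltr_pM2l.
Qed.

Lemma measurable_koranyi_norm (R : realType) :
  measurable_fun setT (@koranyi_norm R).
Proof.
apply: (measurableT_comp (measurable_powR _)).
do ? [apply: measurable_funD|apply: measurable_funX] => //;
do ? apply: measurableT_comp => //.
Qed.

(* [lebesgue3] is a measure on a product of copies of [measurableTypeR R], which
   is only convertible to the [R * R * R] of [koranyi_ball]. *)
Lemma measurable_koranyi_ball (R : realType) (r : R) :
  @measurable _ (measurableTypeR R * measurableTypeR R * measurableTypeR R)%type
    (koranyi_ball r).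
Proof.
rewrite (_ : koranyi_ball r = @koranyi_norm R @^-1` `]-oo, r[%classic).
  by rewrite -[X in measurable X]setTI; exact: measurable_koranyi_norm.
by apply/seteqP; split=> xi; rewrite /koranyi_ball/= in_itv.
Qed.

Lemma lebesgue3_koranyi_ball (R : realType) (r : R) : 0 < r ->
  (lebesgue3 (koranyi_ball r) = (r ^+ 4)%:E * lebesgue3 (@koranyi_ball R 1))%E.
Proof.
move=> r0; rewrite (@lebesgue3_dilation _ r)//; last first.
  exact: measurable_koranyi_ball.
by rewrite -[X in koranyi_ball X]mulr1 dilation_koranyi_ball.
Qed.

Lemma lebesgue3_cube (R : realType) (a b : R) : a < b ->
  (lebesgue3 (`[a, b] `*` `[a, b] `*` `[a, b]) = ((b - a) ^+ 3)%:E)%E.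
Proof.
move=> ab; transitivity ((@lebesgue_measure R \x @lebesgue_measure R)
    (`[a, b] `*` `[a, b]) * @lebesgue_measure R `[a, b])%E.
  refine (@product_measure1E _ _ (measurableTypeR R * measurableTypeR R)%type
    (measurableTypeR R) R (@lebesgue_measure R \x @lebesgue_measure R)%E
    (@lebesgue_measure R) _ _ _ _) => //.
  exact: measurableX.
have itvE : @lebesgue_measure R `[a, b] = (b - a)%:E.
  by rewrite lebesgue_measure_itv/= lte_fin ab EFinB.
transitivity ((b - a)%:E * (b - a)%:E * (b - a)%:E)%E.
  by rewrite product_measure1E//; congr (_ * _ * _)%E; exact: itvE.
rewrite -!EFinM; congr EFin; ring.
Qed.

(** The unit ball lies in the cube of side 2 centred at the origin. *)
Lemma lebesgue3_koranyi_ball_lty (R : realType) :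
  (lebesgue3 (@koranyi_ball R 1) < +oo)%E.
Proof.
apply: (@le_lt_trans _ _ (lebesgue3 (`[-1, 1] `*` `[-1, 1] `*` `[-1, 1]))).
  apply: le_measure; rewrite ?inE.
  - exact: measurable_koranyi_ball.
  - by do ? apply: measurableX.
  - move=> [[x y] t]; rewrite /koranyi_ball/= koranyi_norm_lt//= expr1n.
    rewrite !in_itv/=.
    have sqr_le1 (z : R) : z ^+ 2 < 1 -> -1 <= z <= 1.
      by move=> z1; apply/andP; split; nra.
    move: (sqr_ge0 x) (sqr_ge0 y) (sqr_ge0 t) => x0 y0 t0 h.
    have rho1 : x ^+ 2 + y ^+ 2 < 1.
      by move: (x ^+ 2 + y ^+ 2) (addr_ge0 x0 y0) h => rho; nra.
    by split; first split; apply: sqr_le1; nra.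
by rewrite lebesgue3_cube ?ltry//; lra.
Qed.

(** * Integrals over the unit ball with weight [|xi|^-2] *)

Lemma measurable_div_sqr_koranyi_norm (R : realType) (f : R * R * R -> R) :
  measurable_fun setT f ->
  measurable_fun setT (fun xi => (f xi / koranyi_norm xi ^+ 2)%:E).
Proof.
move=> mf; apply/measurable_EFinP; apply: measurable_funM => //.
(* As a real power the inverse square is measurable, the origin included: both expressions are 0
   there. *)
rewrite (_ : (fun xi => _) = (@powR R ^~ (- 2%:R)) \o @koranyi_norm R).
  exact: (measurableT_comp (measurable_powR _) (@measurable_koranyi_norm R)).
by apply/funext => xi /=; rewrite powR_invn// koranyi_norm_ge0.
Qed.

Lemma div_sqr_koranyi_norm_ge0 (R : realType) (f : R * R * R -> R) xi :
  0 <= f xi -> (0 <= (f xi / koranyi_norm xi ^+ 2)%:E)%E.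
Proof. by move=> f0; rewrite lee_fin divr_ge0// sqr_ge0. Qed.

Definition unit_ball_integral {R : realType} (f : R * R * R -> R) : \bar R :=
  (\int[lebesgue3]_(xi in koranyi_ball 1) (f xi / koranyi_norm xi ^+ 2)%:E)%E.

Lemma unit_ball_integral_ge0 (R : realType) (f : R * R * R -> R) :
  (forall xi, 0 <= f xi) -> (0 <= unit_ball_integral f)%E.
Proof.
by move=> f0; apply: integral_ge0 => xi _; exact: div_sqr_koranyi_norm_ge0.
Qed.

Lemma unit_ball_integralZ (R : realType) (k : R) (f : R * R * R -> R) :
  0 <= k -> measurable_fun setT f -> (forall xi, 0 <= f xi) ->
  (unit_ball_integral (fun xi => (k * f xi)%R) = k%:E * unit_ball_integral f)%E.
Proof.
move=> k0 mf f0; have mB := measurable_koranyi_ball R 1.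
rewrite /unit_ball_integral -ge0_integralZl_EFin//; last 2 first.
- by move=> xi _; exact: div_sqr_koranyi_norm_ge0.
- by apply: measurable_funTS; exact: measurable_div_sqr_koranyi_norm.
by apply: eq_integral => xi _; rewrite -EFinM mulrA.
Qed.

Lemma unit_ball_integralD (R : realType) (f g : R * R * R -> R) :
  measurable_fun setT f -> (forall xi, 0 <= f xi) ->
  measurable_fun setT g -> (forall xi, 0 <= g xi) ->
  (unit_ball_integral (fun xi => (f xi + g xi)%R) =
   unit_ball_integral f + unit_ball_integral g)%E.
Proof.
move=> mf f0 mg g0; have mB := measurable_koranyi_ball R 1.
rewrite /unit_ball_integral -ge0_integralD//; last 4 first.
- by move=> xi _; exact: div_sqr_koranyi_norm_ge0.
- by apply: measurable_funTS; exact: measurable_div_sqr_koranyi_norm.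
- by move=> xi _; exact: div_sqr_koranyi_norm_ge0.
- by apply: measurable_funTS; exact: measurable_div_sqr_koranyi_norm.
by apply: eq_integral => xi _; rewrite -EFinD mulrDl.
Qed.

(** The powers of [r] cancel: [r^-2] from the prefactor, [r^4] from the Jacobian and [r^-2] from the
    homogeneous weight. *)
Lemma heis_functional_dilation (R : realType) (u : R * R * R -> R) (r : R) :
  0 < r -> measurable_fun setT (hgrad_sqnorm u) ->
  heis_functional u r =
  unit_ball_integral (fun xi => hgrad_sqnorm u (dilation r xi)).
Proof.
move=> r0 mu.
have hge0 xi : 0 <= hgrad_sqnorm u xi by rewrite addr_ge0// sqr_ge0.
have mint := measurable_div_sqr_koranyi_norm _ _ mu.
rewrite /heis_functional (@ge0_integral_scale _ _ _ lebesgue3 (dilation r)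
  (r ^+ 4)); last 6 first.
- by rewrite exprn_ge0// ltW.
- exact: measurable_dilation.
- by move=> A mA; exact: lebesgue3_dilation.
- exact: measurable_koranyi_ball.
- exact: measurable_funTS.
- by move=> xi _; exact: div_sqr_koranyi_norm_ge0.
rewrite -[X in koranyi_ball X]mulr1 dilation_koranyi_ball// muleA -EFinM.
rewrite -ge0_integralZl_EFin; last 4 first.
- exact: measurable_koranyi_ball.
- by move=> xi _; exact: div_sqr_koranyi_norm_ge0.
- apply: measurable_funTS.
  by apply: (measurableT_comp mint); exact: measurable_dilation.
- by rewrite mulr_ge0 ?invr_ge0 ?exprn_ge0// ltW.
apply: eq_integral => xi _; rewrite -EFinM koranyi_norm_dilation ?ltW// exprMn.
rewrite [(r ^+ 2 * _)^-1]invfM; congr EFin.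
(* With the inverse square generalised, [field] asks only for [r != 0], and not for a nonzero norm,
   which would fail at the origin. *)
move: (hgrad_sqnorm u _) (koranyi_norm xi ^- 2) => h k.
by field; rewrite gt_eqF.
Qed.

(** * Integrability of the weight near the origin *)

Lemma inv_sqr_le_dyadic (R : realType) (x : R) : 0 < x -> x < 1 ->
  exists k, x < 2 ^- k /\ 1 / x ^+ 2 <= 4 ^+ k.+1.
Proof.
move=> x0 x1.
have ex : exists n, 2 ^- n <= x.
  exists (Num.bound x^-1); rewrite invf_ple ?posrE ?exprn_gt0//; apply: ltW.
  apply: lt_le_trans (archi_boundP _) _; first by rewrite invr_ge0 ltW.
  by rewrite -natrX ler_nat ltnW// ltn_expl.
(* The least [n] with [2 ^- n <= x] is positive since [x < 1]; it is [k.+1], and minimality gives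
   [x < 2 ^- k]. *)
case: (ex_minnP ex) => -[|k]; first by rewrite expr0 invr1 leNgt x1.
move=> kx kmin; exists k; split.
  by rewrite ltNge; apply/negP => /kmin; rewrite ltnn.
rewrite div1r invf_ple ?posrE ?exprn_gt0//.
rewrite (_ : 4 = 2 ^+ 2); last by ring.
rewrite -exprM mulnC exprM -exprVn ler_pXn2r// nnegrE//.
by rewrite ltW.
Qed.

(** Each shell is enlarged to the full ball of radius [2 ^- k]. The sum of the [g k] still dominates
    the weight, and the [k]-th integral is at most [4 ^+ k.+1 * 16 ^- k * V = 4 V / 4 ^+ k]. *)
Lemma unit_ball_integral1_lty (R : realType) :
  (unit_ball_integral (fun=> 1%R : R) < +oo)%E.
Proof.
pose R3 := (measurableTypeR R * measurableTypeR R * measurableTypeR R)%type.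
have mB := measurable_koranyi_ball R.
pose V := fine (lebesgue3 (@koranyi_ball R 1)).
have VE : lebesgue3 (@koranyi_ball R 1) = V%:E.
  by rewrite fineK// ge0_fin_numE ?lebesgue3_koranyi_ball_lty// measure_ge0.
have V0 : 0 <= V by rewrite fine_ge0// measure_ge0.
pose g k (xi : R * R * R) : \bar R :=
  (4 ^+ k.+1 * \1_(koranyi_ball (2 ^- k)) xi)%:E.
have g0 k xi : (0 <= g k xi)%E by rewrite lee_fin mulr_ge0 ?exprn_ge0.
have mg k : measurable_fun (koranyi_ball 1 : set R3) (g k).
  by apply: measurable_funTS; apply/measurable_EFinP; apply: measurable_funM.
apply: (@le_lt_trans _ _ (\int[lebesgue3]_(xi in @koranyi_ball R 1)
    \sum_(0 <= k <oo) g k xi)%E).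
  apply: ge0_le_integral => //.
  - by move=> xi _; exact: div_sqr_koranyi_norm_ge0.
  - by apply: measurable_funTS; exact: measurable_div_sqr_koranyi_norm.
  - by apply: ge0_emeasurable_sum.
  move=> xi /= xi1; have := koranyi_norm_ge0 _ xi.
  rewrite le_eqVlt => /predU1P[<-|xi0].
    (* At the origin the weight is 0 by the convention on division. *)
    by rewrite expr0n/= invr0 mulr0; exact: nneseries_ge0.
  have [k [xik kle]] := inv_sqr_le_dyadic _ _ xi0 xi1.
  (* The partial sum of length [k.+1] ends with the term [g k], which alone bounds the weight. *)
  apply: le_trans (nneseries_lim_ge k.+1 _) => //.
  rewrite big_nat_recr//= -[leLHS]add0e; apply: leeD.
    by apply: sume_ge0 => i _; exact: g0.
  by rewrite lee_fin indicE mem_set ?mulr1.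
rewrite integral_nneseries//.
(* The bound [4 V / 4 ^+ k] is relaxed to [4 V / 2 ^+ k], written [8 V / 2 ^ (k + 1)] to be a
   geometric series of ratio one half with sum [8 V]. *)
apply: (@le_lt_trans _ _
    (\sum_(0 <= k <oo) (8 * V / (2 ^ (k + 1))%:R)%:E)%E); last first.
  by rewrite (cvg_lim _ (@cvg_geometric_eseries_half R (8 * V) 0))// ltry.
apply: lee_nneseries => [k _ _|k _].
  by apply: integral_ge0 => xi _; exact: g0.
rewrite /g; under eq_integral do rewrite EFinM.
rewrite ge0_integralZl_EFin ?exprn_ge0//.
2: by apply/measurable_EFinP; exact: measurable_indic.
rewrite integral_indic//.
apply: (@le_trans _ _
    ((4 ^+ k.+1)%:E * lebesgue3 (@koranyi_ball R (2 ^- k)))%E).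
  apply: lee_wpmul2l; first by rewrite lee_fin exprn_ge0.
  by apply: le_measure; rewrite ?inE//; exact: measurableI.
rewrite lebesgue3_koranyi_ball ?invr_gt0 ?exprn_gt0// VE -!EFinM lee_fin.
rewrite natrX addn1 [4 ^+ _]exprS [2 ^+ k.+1]exprS.
rewrite (_ : 4 ^+ k = (2 ^+ k) ^+ 2); last first.
  by rewrite -exprM mulnC exprM; congr (_ ^+ _); ring.
have : 1 <= 2 ^+ k :> R by rewrite exprn_ege1// ler1n.
move: (2 ^+ k) => p p1; have p0 : p != 0 by rewrite gt_eqF// (lt_le_trans _ p1).
rewrite [leLHS](_ : _ = (4 * V / p) / p); last by field.
rewrite [leRHS](_ : _ = 4 * V / p); last by field.
by rewrite ler_piMr ?invf_le1 ?divr_ge0 ?mulr_ge0// ?(lt_le_trans _ p1)//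
  (le_trans _ p1).
Qed.

Lemma unit_ball_integral_fin_num (R : realType) (f : R * R * R -> R) (c : R) :
  0 <= c -> measurable_fun setT f -> (forall xi, 0 <= f xi) ->
  (forall xi, koranyi_norm xi < 1 -> f xi <= c) ->
  unit_ball_integral f \is a fin_num.
Proof.
move=> c0 mf f0 fc; have mB := measurable_koranyi_ball R 1.
rewrite ge0_fin_numE ?unit_ball_integral_ge0//.
have m1 : measurable_fun setT (fun _ : R * R * R => 1 : R) by [].
apply: (@le_lt_trans _ _ (c%:E * unit_ball_integral (fun=> 1%R : R))%E).
  rewrite -unit_ball_integralZ//; apply: ge0_le_integral => //.
  - by move=> xi _; exact: div_sqr_koranyi_norm_ge0.
  - by apply: measurable_funTS; exact: measurable_div_sqr_koranyi_norm.
  - apply: measurable_funTS; apply: measurable_div_sqr_koranyi_norm.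
    exact: measurable_funM.
  move=> xi xi1; rewrite lee_fin mulr1 ler_wpM2r ?invr_ge0 ?sqr_ge0//.
  exact: fc.
by rewrite lte_mul_pinfty ?lee_fin// unit_ball_integral1_lty.
Qed.

(** * Positivity of the coefficient of [- 12 r ^+ 2] *)

(** On the cube [Q] one has [x^2 + y^2 >= 2 / 16] and [|xi|^4 <= 1/4 + 1/4 < 1]. Hence [Q] lies in
    the unit ball, where dividing by [|xi|^2] only increases, and the integrand is at least [1/8] on
    a set of volume [(1/4)^3]. *)
Lemma unit_ball_integral_rho_gt0 (R : realType) :
  (0 < unit_ball_integral
    (fun xi : R * R * R => (xi.1.1 ^+ 2 + xi.1.2 ^+ 2)%R))%E.
Proof.
have mB := measurable_koranyi_ball R 1.
pose Q : set (measurableTypeR R * measurableTypeR R * measurableTypeR R) :=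
  `[4^-1, 2^-1] `*` `[4^-1, 2^-1] `*` `[4^-1, 2^-1].
have mQ : measurable Q by do ? apply: measurableX.
have mf : measurable_fun setT (fun xi : R * R * R =>
    ((xi.1.1 ^+ 2 + xi.1.2 ^+ 2) / koranyi_norm xi ^+ 2)%:E).
  apply: measurable_div_sqr_koranyi_norm.
  by do ? [apply: measurable_funD|apply: measurable_funX] => //;
    do ? apply: measurableT_comp.
have rho0 (xi : R * R * R) : 0 <= xi.1.1 ^+ 2 + xi.1.2 ^+ 2.
  by rewrite addr_ge0// sqr_ge0.
have f0 (xi : R * R * R) :
    (0 <= ((xi.1.1 ^+ 2 + xi.1.2 ^+ 2) / koranyi_norm xi ^+ 2)%:E)%E.
  exact: (div_sqr_koranyi_norm_ge0 _ (fun z => z.1.1 ^+ 2 + z.1.2 ^+ 2)).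
have Qrho xi : Q xi ->
    8^-1 <= xi.1.1 ^+ 2 + xi.1.2 ^+ 2 <= 2^-1 /\ xi.2 ^+ 2 <= 4^-1.
  case: xi => [[x y] t]; rewrite /Q/= !in_itv/=.
  move=> [[/andP[? ?] /andP[? ?]] /andP[? ?]].
  by split; [apply/andP; split|]; nra.
have QB : Q `<=` koranyi_ball 1.
  move=> xi /Qrho[/andP[rho1 rho2] t1].
  by rewrite /koranyi_ball/= koranyi_norm_lt// expr1n; nra.
apply: (@lt_le_trans _ _ (\int[lebesgue3]_(xi in Q) (cst (8^-1)%:E xi))%E).
  have -> : (\int[lebesgue3]_(xi in Q) (cst (8^-1)%:E xi) =
      (8^-1)%:E * ((2^-1 - 4^-1) ^+ 3)%:E :> \bar R)%E.
    rewrite integral_cst//; congr (_ * _)%E.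
    by apply: (lebesgue3_cube R); lra.
  by rewrite -EFinM lte_fin mulr_gt0// exprn_gt0//; lra.
apply: le_trans (ge0_subset_integral _ mQ mB _ _ QB) => //; last first.
  exact: measurable_funTS.
apply: ge0_le_integral => //.
- by move=> xi _; rewrite lee_fin invr_ge0.
- exact: measurable_funTS.
move=> xi Qxi; rewrite lee_fin.
have [/andP[rho1 _] _] := Qrho _ Qxi.
have k0 : 0 < koranyi_norm xi.
  rewrite lt_neqAle koranyi_norm_ge0 andbT; apply/eqP => k0.
  have := koranyi_normX4 _ xi; rewrite -k0 expr0n/=.
  by move: (sqr_ge0 xi.2); nra.
rewrite ler_pdivlMr ?exprn_gt0//; apply: le_trans rho1.
by rewrite ler_piMr// expr_le1// ltW//; exact: QB.
Qed.

(** * Expansion of the functional in [r] and monotonicity *)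

Lemma hgrad_sqnorm_u_cubic (R : realType) (xi : R * R * R) :
  hgrad_sqnorm (@u_cubic R) xi =
  (1 - 6 * (xi.1.1 ^+ 2 + xi.1.2 ^+ 2)) ^+ 2 +
  (6 * xi.1.1 * xi.1.2 - 3 * xi.2) ^+ 2.
Proof. by rewrite /hgrad_sqnorm /hgrad/= heisX_u_cubic heisY_u_cubic. Qed.

Lemma measurable_hgrad_sqnorm_u_cubic (R : realType) :
  measurable_fun setT (hgrad_sqnorm (@u_cubic R)).
Proof.
rewrite (funext (@hgrad_sqnorm_u_cubic R)).
do ? [apply: measurable_funX|apply: measurable_funB|apply: measurable_funD
     |apply: measurable_funM] => //;
by do ? apply: measurableT_comp.
Qed.

(** With [rho = x^2 + y^2], the squared gradient at the dilated point is [(1 - 6 r^2 rho)^2 + r^4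
    g^2 = f1 - 12 r^2 f2 + r^4 f3]; [a], [b], [c] are the weighted integrals of [f1], [f2], [f3]. *)
Lemma heis_functional_u_cubic (R : realType) :
  exists a b c : R, [/\ 0 < b, 0 <= c & forall r, 0 < r ->
    heis_functional (@u_cubic R) r = (a - 12 * r ^+ 2 * b + r ^+ 4 * c)%:E].
Proof.
pose f1 (xi : R * R * R) : R := 1.
pose f2 (xi : R * R * R) : R := xi.1.1 ^+ 2 + xi.1.2 ^+ 2.
pose g (xi : R * R * R) : R := 6 * xi.1.1 * xi.1.2 - 3 * xi.2.
pose f3 (xi : R * R * R) : R := (6 * f2 xi) ^+ 2 + g xi ^+ 2.
have mf1 : measurable_fun setT f1 by exact: measurable_cst.
have mf2 : measurable_fun setT f2.
  do ? [apply: measurable_funX|apply: measurable_funD] => //;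
  by do ? apply: measurableT_comp.
have mg : measurable_fun setT g.
  do ? [apply: measurable_funB|apply: measurable_funM] => //;
  by do ? apply: measurableT_comp.
have mf3 : measurable_fun setT f3.
  apply: measurable_funD; apply: measurable_funX => //.
  exact: measurable_funM.
have f10 xi : 0 <= f1 xi by [].
have f20 xi : 0 <= f2 xi by rewrite addr_ge0// sqr_ge0.
have f30 xi : 0 <= f3 xi by rewrite addr_ge0// sqr_ge0.
have f2le xi : koranyi_norm xi < 1 -> f2 xi <= 1.
  rewrite koranyi_norm_lt// expr1n -/(f2 xi).
  by move: (sqr_ge0 xi.2) (f20 xi); nra.
(* Any finite bound serves: [f3 <= 36 rho^2 + 18 rho^2 + 18 t^2 <= 72], and [117 = 6^2 + 9^2] leaves
   room. *)
have f3le xi : koranyi_norm xi < 1 -> f3 xi <= 117.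
  move=> xi1; have := f2le _ xi1; move: xi1 (f20 xi).
  rewrite koranyi_norm_lt// expr1n /f3 -/(f2 xi) => h p0 p1.
  have t1 : xi.2 ^+ 2 <= 1 by move: (sqr_ge0 (f2 xi)); lra.
  have : g xi ^+ 2 <= 18 * f2 xi ^+ 2 + 18 * xi.2 ^+ 2.
    (* Combines [(p - q)^2 + (p + q)^2 = 2 p^2 + 2 q^2] for [p = 6 x y], [q = 3 t] with
       [4 x^2 y^2 = rho^2 - (x^2 - y^2)^2]. *)
    rewrite -subr_ge0 (_ : _ - _ = (6 * xi.1.1 * xi.1.2 + 3 * xi.2) ^+ 2 +
      18 * (xi.1.1 ^+ 2 - xi.1.2 ^+ 2) ^+ 2); last by rewrite /f2 /g; ring.
    by rewrite addr_ge0 ?sqr_ge0// mulr_ge0 ?sqr_ge0.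
  by nra.
have J1 : unit_ball_integral f1 \is a fin_num.
  by apply: (unit_ball_integral_fin_num _ _ 1).
have J2 : unit_ball_integral f2 \is a fin_num.
  by apply: (unit_ball_integral_fin_num _ _ 1).
have J3 : unit_ball_integral f3 \is a fin_num.
  by apply: (unit_ball_integral_fin_num _ _ 117).
exists (fine (unit_ball_integral f1)), (fine (unit_ball_integral f2)),
  (fine (unit_ball_integral f3)); split.
- by rewrite fine_gt0// unit_ball_integral_rho_gt0 ltey_eq J2.
- by rewrite fine_ge0// unit_ball_integral_ge0.
move=> r r0.
rewrite heis_functional_dilation//; last exact: measurable_hgrad_sqnorm_u_cubic.
set h := fun xi => hgrad_sqnorm _ (dilation r xi).
have h0 xi : 0 <= h xi by rewrite addr_ge0// sqr_ge0.
have mh : measurable_fun setT h.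
  apply: (measurableT_comp (measurable_hgrad_sqnorm_u_cubic R)).
  exact: measurable_dilation.
have c2 : 0 <= 12 * r ^+ 2 by rewrite mulr_ge0// sqr_ge0.
have c4 : 0 <= r ^+ 4 by rewrite exprn_ge0// ltW.
(* Moving the only negative term to the left keeps all integrands
   nonnegative, so that no integrability is needed. *)
have hE : (unit_ball_integral h + (12 * r ^+ 2)%:E * unit_ball_integral f2 =
    unit_ball_integral f1 + (r ^+ 4)%:E * unit_ball_integral f3)%E.
  rewrite -!unit_ball_integralZ// -!unit_ball_integralD//;
    try by [move=> xi; exact: mulr_ge0|exact: measurable_funM].
  congr unit_ball_integral; apply/funext => xi.
  by rewrite /h hgrad_sqnorm_u_cubic /f1 /f3 /f2 /g/=; ring.
move/(congr1 (fun z => z - (12 * r ^+ 2)%:E * unit_ball_integral f2)%E): hE.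
rewrite addeK ?fin_numM// => ->.
rewrite -[in LHS](fineK J1) -[in LHS](fineK J2) -[in LHS](fineK J3).
by rewrite -!EFinM -EFinD; congr EFin; ring.
Qed.

Theorem lemma5p1 (R : realType) :
  (forall xi : R * R * R, kohn_laplace (@u_cubic R) xi = 0) /\
  (exists r0 : R, 0 < r0 /\
    forall r s : R, 0 < r -> r < s -> s < r0 ->
      (heis_functional (@u_cubic R) s < heis_functional (@u_cubic R) r)%E).
Proof.
split; first exact: kohn_laplace_u_cubic.
have [a [b [c [b0 c0 IE]]]] := heis_functional_u_cubic R.
have c1 : 0 < c + 1 by lra.
(* For [r < s < 1] one has [c (s^2 + r^2) <= 2 c s], and [s (c + 1) < b] keeps this below [12 b].
   The denominator is [c + 1] because [c] may be 0. *)
exists (Num.min 1 (b / (c + 1))); split.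
  by rewrite lt_min ltr01 divr_gt0.
move=> r s r0 rs; rewrite lt_min ltr_pdivlMr// => /andP[s1 sb].
have s0 : 0 < s := lt_trans r0 rs.
rewrite !IE// lte_fin -subr_gt0.
rewrite (_ : _ - _ = (s ^+ 2 - r ^+ 2) * (12 * b - c * (s ^+ 2 + r ^+ 2)));
  last by ring.
have rs2 : r ^+ 2 < s ^+ 2 by rewrite ltr_pXn2r// nnegrE ltW.
have s2s : s ^+ 2 <= s by rewrite expr2 ler_piMl// ltW.
rewrite mulr_gt0// subr_gt0//.
have : c * (s ^+ 2 + r ^+ 2) <= c * (2 * s) by apply: ler_wpM2l => //; lra.
by lra.
Qed.
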